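(* Let $G$ be a graph on $n\ge 7$ vertices and let $r\ge 1$ be an integer with $r\le \log_2 n$. Then the $K_r$-count $\mathrm{k}_r(G)$ is reconstructible from $n-1$ cards.
   Context: Graphs are finite and simple. For a graph $G$ and $v\in V(G)$, the card $G-v$ is the unlabelled induced subgraph $G[V(G)\setminus\{v\}]$ (i.e. considered up to isomorphism). The deck $\mathcal{D}(G)$ is the multiset of all cards $G-v$, $v\in V(G)$. The $K_r$-count $\mathrm{k}_r(G)$ is the number of $r$-element vertex subsets of $G$ that induce a complete graph. A quantity $f(G)$ of an $n$-vertex graph $G$ is reconstructible from $n-1$ cards if for every graph $H$ which has at least $n-1$ cards in common with $G$ (decks compared as multisets of isomorphism classes) we have $f(H)=f(G)$. *)

(* Defs.v *)
From HB Require Import structures.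
From mathcomp Require Import all_boot all_order all_algebra.
From mathcomp Require Import finmap multiset.
From mathcomp Require Import reals exp.

Set Implicit Arguments.
Unset Strict Implicit.
Unset Printing Implicit Defensive.

Record sgraph := SGraph {
  svertex :> finType;
  sedge : rel svertex;
  sedge_sym : symmetric sedge;
  sedge_irrefl : irreflexive sedge }.

Section InducedSubgraph.
Variables (G : sgraph) (S : {set G}).

Definition induced_rel : rel {x : G | x \in S} :=
  fun x y => sedge (val x) (val y).

Lemma induced_sym : symmetric induced_rel.
Proof. by move=> x y; apply: sedge_sym. Qed.

Lemma induced_irrefl : irreflexive induced_rel.
Proof. by move=> x; apply: sedge_irrefl. Qed.

Definition induced : sgraph := SGraph induced_sym induced_irrefl.
End InducedSubgraph.

Definition del_vertex (G : sgraph) (v : G) : sgraph := induced [set~ v].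

Definition giso (G H : sgraph) : Prop :=
  exists2 f : G -> H, bijective f & forall x y, sedge (f x) (f y) = sedge x y.

(* An unlabelled graph of order m is represented by the set of all adjacency
   relations on 'I_m that are isomorphic to it; see isoclassP. *)
Definition unlabelled : choiceType := {m : nat & {set {set 'I_m * 'I_m}}}.

Definition labelling (G : sgraph) (m : nat) (E : {set 'I_m * 'I_m})
    (f : {ffun 'I_m -> G}) : bool :=
  injectiveb f && [forall i, forall j, ((i, j) \in E) == sedge (f i) (f j)].

(* Injectivity suffices here since #|'I_#|G| | = #|G|. *)
Definition isoclass (G : sgraph) : unlabelled :=
  Tagged (fun m => {set {set 'I_m * 'I_m}})
    [set E : {set 'I_#|G| * 'I_#|G|} |
      [exists f : {ffun 'I_#|G| -> G}, labelling E f]].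

Lemma isoclassP (G H : sgraph) : isoclass G = isoclass H <-> giso G H.
Proof.
have lab_sub (A B : sgraph) m (E : {set 'I_m * 'I_m}) : giso A B ->
    [exists f : {ffun 'I_m -> A}, labelling E f] ->
    [exists f : {ffun 'I_m -> B}, labelling E f].
  move=> [h hb he] /existsP[f /andP[/injectiveP fi /forallP fe]].
  apply/existsP; exists [ffun i => h (f i)]; apply/andP; split.
    by apply/injectiveP => i j; rewrite !ffunE => /(bij_inj hb) /fi.
  apply/forallP => i; apply/forallP => j; rewrite !ffunE he.
  exact: (forallP (fe i) j).
have giso_sym (A B : sgraph) : giso A B -> giso B A.
  move=> [h [g hK gK] he]; exists g; first by exists h.
  by move=> x y; rewrite -he !gK.
have isoE (K : sgraph) m (e : #|K| = m) :
    isoclass K = Tagged (fun m => {set {set 'I_m * 'I_m}})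
      [set E : {set 'I_m * 'I_m} | [exists f : {ffun 'I_m -> K}, labelling E f]].
  by case: m / e.
split=> [eGH|iGH]; last first.
  have eHG : #|H| = #|G|.
    by case: iGH => h hb _; rewrite (bij_eq_card hb).
  rewrite (isoE _ _ eHG) (isoE G _ erefl); congr (Tagged _ _).
  apply/setP => E; rewrite !inE; apply/idP/idP; apply: lab_sub => //.
  exact: giso_sym.
have eHG : #|H| = #|G| by rewrite -[#|H|]/(tag (isoclass H)) -eGH.
move: eGH; rewrite (isoE _ _ eHG) (isoE G _ erefl).
move/eqP; rewrite eq_Tagged /= => /eqP/setP eE.
pose E0 := [set p : 'I_#|G| * 'I_#|G| | sedge (enum_val p.1 : G) (enum_val p.2)].
have := eE E0; rewrite !inE.
have -> : [exists f : {ffun 'I_#|G| -> G}, labelling E0 f].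
  apply/existsP; exists [ffun i => enum_val i]; apply/andP; split.
    by apply/injectiveP => i j; rewrite !ffunE => /enum_val_inj.
  by apply/forallP => i; apply/forallP => j; rewrite !ffunE inE.
move=> /esym/existsP[f /andP[/injectiveP fi /forallP fe]].
exists (fun x => f (enum_rank x)).
  apply: inj_card_bij; last by rewrite eHG.
  by move=> x y /fi /enum_rank_inj.
move=> x y; have /eqP <- := forallP (fe (enum_rank x)) (enum_rank y).
by rewrite inE /= !enum_rankK.
Qed.

Definition deck (G : sgraph) : {mset unlabelled}%mset :=
  seq_mset [seq isoclass (del_vertex v) | v : G].

(* size counts multiplicities, whereas #|_| would count distinct cards. *)
Definition common_cards (G H : sgraph) : nat :=
  size (deck G `&` deck H)%mset.

Definition reconstructible_from (T : Type) (f : sgraph -> T) (G : sgraph)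
    (k : nat) : Prop :=
  forall H : sgraph, k <= common_cards G H -> f H = f G.

Definition complete_on (G : sgraph) (A : {set G}) : bool :=
  [forall x in A, forall y in A, (x != y) ==> sedge x y].

Definition clique_count (r : nat) (G : sgraph) : nat :=
  #|[set A : {set G} | (#|A| == r) && complete_on A]|.

Definition log2 (R : realType) (x : R) : R := (ln x / ln 2)%R.

(* Main.v *)
Require Import Defs.
From mathcomp Require Import all_boot all_order all_algebra.
From mathcomp Require Import fingroup perm finmap multiset.
From mathcomp Require Import reals exp.
From mathcomp Require Import zify.

(* Identify V(H) with V(G) so that the n - 1 common cards are those of equal
   vertices, v0 being the exceptional vertex.  If k_r(G) = k_r(H) + D with D > 0,
   then every v <> v0 lies in D more r-cliques in G than in H, while v0 lies in
   (n - 1 - r) D more in H than in G.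

   For r = 2 this leaves D = 1 and deg_G v0 <= 2.  The cases deg v0 = 0 and 2 are
   complementary and are refuted by counting isolated vertices on the cards.  If
   deg v0 = 1, counting vertices of degree <= 1 on the cards forces n = 7 and at
   most two vertices other than v0 of degree <= 3; the same bound in the complement
   contradicts n = 7.

   For r >= 3 all degrees agree.  Let S be the vertices of maximum degree, each
   with k non-neighbours.  For v <> v0, the members of S not adjacent to v can be
   recognised on the card of v, with their numbers of r-cliques intact.  This forces
   v0 to be in S, the r-clique degrees on S to be pairwise distinct and to form the
   progression a(v0), a(v0) + D, ..., a(v0) + (n - 1 - r) D, and S to be a clique.
   So at most r vertices lie outside S, and a vertex of S is determined, up to
   exchanging twins, by its k non-neighbours there; hence n - r <= C(r, k), which
   contradicts 2^r <= n. *)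

Set Implicit Arguments.
Unset Strict Implicit.
Unset Printing Implicit Defensive.

Import Order.TTheory GRing.Theory Num.Theory.

(** * Clique counts and degrees *)

Definition cliques (V : finType) (e : rel V) (r : nat) : {set {set V}} :=
  [set A : {set V} | (#|A| == r) &&
     [forall x in A, forall y in A, (x != y) ==> e x y]].

Definition kcount (V : finType) (e : rel V) (r : nat) : nat := #|cliques e r|.

Definition kdeg (V : finType) (e : rel V) (r : nat) (x : V) : nat :=
  #|[set A in cliques e r | x \in A]|.

Definition deg (V : finType) (e : rel V) (x : V) : nat := #|[set y | e x y]|.

Definition compl (V : finType) (e : rel V) : rel V :=
  fun x y => (x != y) && ~~ e x y.

Lemma cliquesP (V : finType) (e : rel V) r (A : {set V}) :
  reflect (#|A| = r /\ {in A &, forall x y, x != y -> e x y}) (A \in cliques e r).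
Proof.
rewrite inE; apply: (iffP andP) => [[/eqP cA /forallP eA]|[cA eA]]; split=> //.
- move=> x y xA yA xy; have /implyP/(_ xA)/forallP/(_ y) := eA x.
  by move/implyP/(_ yA)/implyP; apply.
- exact/eqP.
apply/forallP => x; apply/implyP => xA; apply/forallP => y; apply/implyP => yA.
by apply/implyP => xy; apply: eA.
Qed.

(** Adjacency has to be preserved only inside the sets selected by [P], so a map that is an
    isomorphism only away from a deleted vertex is allowed. *)
Lemma card_cliques_le (V W : finType) (e : rel V) (e' : rel W) (f : V -> W) r
    (P : pred {set V}) (Q : pred {set W}) :
  injective f ->
  (forall A, P A -> {in A &, forall x y, e' (f x) (f y) = e x y} /\ Q (f @: A)) ->
  #|[set A in cliques e r | P A]| <= #|[set B in cliques e' r | Q B]|.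
Proof.
move=> fi H; rewrite -(card_imset _ (imset_inj fi)); apply: subset_leq_card.
apply/subsetP => _ /imsetP[A + ->]; rewrite inE => /andP[/cliquesP[cA eA] /H[ef QA]].
rewrite inE QA andbT; apply/cliquesP; split; first by rewrite card_imset.
move=> _ _ /imsetP[x xA ->] /imsetP[y yA ->] xy; rewrite ef //; apply: eA => //.
by apply: contraNneq xy => ->.
Qed.

Lemma sum_kdeg (V : finType) (e : rel V) r :
  \sum_x kdeg e r x = r * kcount e r.
Proof.
transitivity (\sum_x \sum_(A in cliques e r) (x \in A : nat)).
  apply: eq_bigr => x _; rewrite /kdeg -sum1_card.
  rewrite (eq_bigl (fun A => (A \in cliques e r) && (x \in A))) => [|A].
    by rewrite big_mkcondr; apply: eq_bigr => A _; case: (x \in A).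
  by rewrite inE.
rewrite exchange_big /= mulnC -sum_nat_const; apply: eq_bigr => A /cliquesP[<- _].
by rewrite -sum1_card [RHS]big_mkcond; apply: eq_bigr => x _; case: (x \in A).
Qed.

Lemma card_cliques_split (V : finType) (e : rel V) r (x : V) :
  kcount e r = kdeg e r x + #|[set A in cliques e r | x \notin A]|.
Proof.
rewrite /kcount -(cardsID [set A : {set V} | x \in A]) /kdeg; congr (_ + _);
  by apply: eq_card => A; rewrite !inE // andbC.
Qed.

(** * Complements, and cliques through an almost dominating vertex *)

Section Compl.
Variables (V : finType) (e : rel V).
Hypotheses (e_sym : symmetric e) (e_irr : irreflexive e).

Lemma compl_sym : symmetric (compl e).
Proof. by move=> x y; rewrite /compl eq_sym e_sym. Qed.

Lemma compl_irr : irreflexive (compl e).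
Proof. by move=> x; rewrite /compl eqxx. Qed.

Lemma complK : compl (compl e) =2 e.
Proof.
by move=> x y; rewrite /compl; case: eqP => [->|_] /=; rewrite ?e_irr // negbK.
Qed.

Lemma deg_compl x : deg e x + deg (compl e) x = #|V|.-1.
Proof.
rewrite -cardsT (cardsD1 x) inE add1n /= /deg -(cardsID [set y | e x y] (setT :\ x)).
congr (_ + _); apply: eq_card => y; rewrite !inE.
  by rewrite andbT; case: eqP => // ->; rewrite e_irr.
by rewrite /compl eq_sym andbT andbC.
Qed.

Lemma kdeg2 x : kdeg e 2 x = deg e x.
Proof.
have inj : {in [set y | e x y] &, injective (fun y => [set x; y])}.
  move=> y z; rewrite !inE => exy exz /setP/(_ y); rewrite !inE eqxx orbT.
  by move/esym/orP=> [/eqP yx|/eqP //]; move: exy; rewrite yx e_irr.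
rewrite /kdeg /deg -(card_in_imset inj); apply: eq_card => A.
rewrite inE; apply/andP/imsetP => [[/cliquesP[/eqP/cards2P[y [z [yz ->]]] eA] xA]|].
  have [xy|xz] : x = y \/ x = z by move: xA; rewrite !inE => /orP[]/eqP; tauto.
    exists z; last by rewrite xy.
    by rewrite inE xy; apply: eA; rewrite ?inE ?eqxx ?orbT.
  exists y; last by rewrite xz setUC.
  by rewrite inE xz; apply: eA; rewrite ?inE ?eqxx ?orbT // eq_sym.
move=> [y]; rewrite inE => exy ->; have xy : x != y.
  by apply: contraTneq exy => ->; rewrite e_irr.
split; last by rewrite !inE eqxx.
apply/cliquesP; split; first by rewrite cards2 xy.
move=> u v; rewrite !inE => /orP[]/eqP-> /orP[]/eqP->; rewrite ?eqxx // => _.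
by rewrite e_sym.
Qed.

(* Every r-clique that avoids u and its (at most one) non-neighbour extends by u. *)
Lemma cliques_near_dominating r u : deg (compl e) u <= 1 ->
  kdeg e r.+1 u + kdeg e r u + \sum_(v | compl e u v) kdeg e r v =
  kcount e r.
Proof.
move=> cu; pose X := [set A in cliques e r | u \notin A & [disjoint A & [set v | compl e u v]]].
(* Deleting [u] from an [r.+1]-clique through [u] leaves an [r]-clique among the neighbours of [u],
   and conversely. *)
have extX : kdeg e r.+1 u = #|X|.
  have inj : {in X &, injective (fun A => u |: A)}.
    move=> A B; rewrite !inE => /and3P[_ uA _] /and3P[_ uB _] AB.
    by rewrite -(setU1K uA) AB setU1K.
  rewrite -(card_in_imset inj); apply: eq_card => A.
  rewrite inE; apply/andP/imsetP => [[/cliquesP[cA eA] uA]|[B]].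
    exists (A :\ u); last by rewrite setD1K.
    rewrite inE; apply/and3P; split; last 2 first.
    - by rewrite !inE eqxx.
    - rewrite -setI_eq0; apply/eqP/setP => v; rewrite !inE /compl.
      apply/negP => /andP[/andP[vu vA] /andP[uv /negP]]; apply.
      exact: eA.
    apply/cliquesP; split; first by move: cA; rewrite (cardsD1 u) uA => -[].
    by move=> x y /setD1P[_ xA] /setD1P[_ yA]; apply: eA.
  rewrite inE => /and3P[/cliquesP[cB eB] uB dB] ->; rewrite setU11; split=> //.
  have adj v : v \in B -> e u v.
    move=> vB; have := disjointFr dB vB; rewrite inE /compl.
    have -> : u != v by apply: contraNneq uB => ->.
    by move=> /negbT; rewrite negbK.
  apply/cliquesP; split; first by rewrite cardsU1 uB cB.
  move=> x y /setU1P[->|xB] /setU1P[->|yB]; rewrite ?eqxx // => xy.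
  - exact: adj.
  - by rewrite e_sym; apply: adj.
  - exact: eB.
rewrite (card_cliques_split e r u) extX (addnC #|X|) -addnA; congr (_ + _).
move: cu; rewrite leq_eqVlt => /orP[/cards1P[w Ew]|]; last first.
  rewrite ltnS leqn0 => /eqP/cards0_eq E0.
  rewrite [X in _ + X]big_pred0 ?addn0 => [|v]; last by move/setP/(_ v): E0; rewrite !inE.
  by apply: eq_card => A; rewrite !inE E0 -setI_eq0 setI0 eqxx andbT.
(* With a single non-neighbour [w], the [r]-cliques avoiding [u] either miss [w] and lie in [X], or
   contain [w]; a clique through [w] avoids [u] anyway. *)
have cw v : compl e u v = (v == w) by move/setP/(_ v): Ew; rewrite !inE.
rewrite (eq_bigl (pred1 w)) ?big_pred1_eq; last exact: cw.
rewrite -[RHS](cardsID [set A : {set V} | w \in A]) addnC; congr (_ + _).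
  apply: eq_card => A; rewrite inE [RHS]inE [X in _ = X && _]inE [X in _ = _ && X]inE.
  rewrite -andbA; case AC: (A \in cliques e r) => //=.
  case wA: (w \in A); rewrite ?andbF ?andbT //=; apply/esym/negP => uA.
  move: AC => /cliquesP[_ /(_ u w uA wA)]; have := cw w.
  by rewrite eqxx /compl => /andP[-> /negP euw] /(_ isT).
apply: eq_card => A; rewrite !inE Ew disjoint_sym disjoints1.
by case: (w \in A); rewrite ?andbF ?andbT.
Qed.
End Compl.

(** * Graphs with a common card *)

(** An isomorphism between the cards of [v], extended by fixing [v] so that it can be inverted as a
    permutation of [V]; adjacencies with [v] are unconstrained. *)
Definition card_iso (V : finType) (e e' : rel V) (v : V) (f : {perm V}) : Prop :=
  f v = v /\ forall x y, x != v -> y != v -> e' (f x) (f y) = e x y.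

Definition same_cards (V : finType) (e e' : rel V) (v0 : V) : Prop :=
  forall v, v != v0 -> exists f, card_iso e e' v f.

Section CardIso.
Variables (V : finType) (e e' : rel V).

Lemma card_iso_neq v f x : card_iso e e' v f -> (f x != v) = (x != v).
Proof. by case=> fv _; rewrite -{1}fv (inj_eq perm_inj). Qed.

Lemma card_iso_sym v f : card_iso e e' v f -> card_iso e' e v f^-1%g.
Proof.
move=> fP; have [fv fE] := fP; split=> [|x y xv yv].
  by rewrite -{1}fv permK.
by rewrite -fE ?permKV // -(card_iso_neq _ fP) permKV.
Qed.

Lemma card_iso_compl v f : card_iso e e' v f -> card_iso (compl e) (compl e') v f.
Proof.
by case=> fv fE; split=> // x y xv yv; rewrite /compl fE // (inj_eq perm_inj).
Qed.

Lemma same_cards_sym v0 : same_cards e e' v0 -> same_cards e' e v0.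
Proof. by move=> H v /H[f /card_iso_sym fP]; exists f^-1%g. Qed.

Lemma same_cards_compl v0 :
  same_cards e e' v0 -> same_cards (compl e) (compl e') v0.
Proof. by move=> H v /H[f /card_iso_compl fP]; exists f. Qed.

(** Both sides are the degree of [x] on the card plus the two adjacencies with [v]; the additive
    form avoids truncated subtraction. *)
Lemma card_iso_deg v f x : card_iso e e' v f -> x != v ->
  deg e x + e' (f x) v = deg e' (f x) + e x v.
Proof.
move=> [fv fE] xv.
have degE (g : rel V) y : deg g y = g y v + #|[set z | g y z & z != v]|.
  rewrite /deg (cardsD1 v) inE; congr (_ + _).
  by apply: eq_card => z; rewrite !inE andbC.
rewrite !degE addnAC [RHS]addnAC [e x v + _]addnC; congr (_ + _).
rewrite -(card_imset _ (@perm_inj _ f)); apply: eq_card => z.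
apply/imsetP/idP => [[y]|]; rewrite inE => /andP[xy yv].
  by move=> ->; rewrite inE fE // xy -[X in _ != X]fv (inj_eq perm_inj).
exists (f^-1%g z); last by rewrite permKV.
have zv : f^-1%g z != v by rewrite -(inj_eq (@perm_inj _ f)) permKV fv.
by rewrite inE zv -fE // permKV xy.
Qed.
End CardIso.

(** * Clique degrees across a common card *)

Section CardIsoCliques.
Variable V : finType.

Lemma card_iso_cliques_le (e e' : rel V) v f r (P : pred {set V}) (Q : pred {set V}) :
  card_iso e e' v f -> (forall A, P A -> v \notin A /\ Q (f @: A)) ->
  #|[set A in cliques e r | P A]| <= #|[set A in cliques e' r | Q A]|.
Proof.
move=> [_ fE] PQ; apply: (card_cliques_le (f := f)) => [|A /PQ[vA QA]].
  exact: perm_inj.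
by split=> // x y xA yA; apply: fE; apply: contraNneq vA => <-.
Qed.

Lemma card_iso_avoid_le (e e' : rel V) v f r : card_iso e e' v f ->
  #|[set A in cliques e r | v \notin A]| <= #|[set A in cliques e' r | v \notin A]|.
Proof.
move=> fP; have [fv _] := fP; apply: (card_iso_cliques_le (f := f)) fP _ => A vA.
by split=> //; rewrite -fv (mem_imset _ _ perm_inj).
Qed.

(** A clique through [x] cannot contain the non-neighbour [v], so it survives on the card. *)
Lemma card_iso_kdeg_le (e e' : rel V) v f r x : card_iso e e' v f -> x != v ->
  ~~ e x v -> kdeg e r x <= kdeg e' r (f x).
Proof.
move=> fP xv nxv; rewrite /kdeg.
have -> : [set A in cliques e r | x \in A] =
          [set A in cliques e r | (x \in A) && (v \notin A)].
  apply/setP => A; rewrite inE [RHS]inE; case AC: (A \in cliques e r) => //=.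
  case xA: (x \in A) => //=; apply/esym; apply: contra nxv => vA.
  by move/cliquesP: AC => [_]; apply.
apply: (card_iso_cliques_le (f := f)) fP _ => A /andP[xA vA].
by rewrite (mem_imset _ _ perm_inj).
Qed.

Lemma card_iso_kdeg (e e' : rel V) v f r x : card_iso e e' v f -> x != v ->
  ~~ e x v -> ~~ e' (f x) v -> kdeg e r x = kdeg e' r (f x).
Proof.
move=> fP xv nxv nfxv; apply/eqP; rewrite eqn_leq (card_iso_kdeg_le _ fP) //=.
rewrite -{2}(permK f x); apply: (card_iso_kdeg_le _ (card_iso_sym fP)) => //.
by rewrite (card_iso_neq _ fP).
Qed.

(** The card of [x] determines the number of cliques avoiding [x], so the whole excess [D] falls on
    the cliques through [x]. *)
Lemma kdeg_same_cards (e e' : rel V) v0 r D : same_cards e e' v0 ->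
  kcount e r = kcount e' r + D ->
  forall x, x != v0 -> kdeg e r x = kdeg e' r x + D.
Proof.
move=> H KD x /H[f fP]; move: KD; rewrite !(card_cliques_split _ r x).
have /anti_leq -> : #|[set A in cliques e r | x \notin A]| <=
                  #|[set A in cliques e' r | x \notin A]| <=
                  #|[set A in cliques e r | x \notin A]|.
  by rewrite (card_iso_avoid_le _ fP) (card_iso_avoid_le _ (card_iso_sym fP)).
by rewrite addnAC => /addIn.
Qed.

(** By [sum_kdeg] the clique degrees differ by [r * D] in total, while the vertices other than [v0]
    contribute [#|V|.-1 * D]; [v0] compensates. *)
Lemma kdeg_special (e e' : rel V) v0 r D : same_cards e e' v0 -> r < #|V| ->
  kcount e r = kcount e' r + D ->
  kdeg e' r v0 = kdeg e r v0 + (#|V|.-1 - r) * D.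
Proof.
move=> H rV KD; have := sum_kdeg e r; have := sum_kdeg e' r.
rewrite (bigD1 v0) //= [in X in _ -> X -> _](bigD1 v0) //=.
rewrite [in X in _ -> X -> _](eq_bigr (fun x => kdeg e' r x + D)); last first.
  by move=> x; apply: kdeg_same_cards.
rewrite big_split /= sum_nat_const (_ : #|_| = #|V|.-1); last exact: cardC1.
rewrite KD mulnDr mulnBl.
have : r * D <= #|V|.-1 * D by rewrite leq_mul2r; apply/orP; right; lia.
move: (_ .-1 * D) (r * D) (r * _) (\sum_(i | _) _) => *; lia.
Qed.
End CardIsoCliques.

(** * Cliques of size at least three *)

Section MaxDegree.
Variables (V : finType) (k : nat).

Definition codeg_set (e : rel V) : {set V} := [set x | deg (compl e) x == k].

(* Deleting [v] lowers the co-degree of its non-neighbours, so those non-neighbours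
   that had the least co-degree [k] are recognised on the card; and no clique
   through them is lost. *)
Lemma nonneighbour_transfer (e e' : rel V) v f r x :
  (forall y, k <= deg (compl e') y) -> card_iso e e' v f ->
  x \in codeg_set e -> compl e x v ->
  [/\ f x \in codeg_set e', compl e' (f x) v & kdeg e r x = kdeg e' r (f x)].
Proof.
move=> k_min fP; rewrite !inE => /eqP dx cxv; have /andP[xv nxv] := cxv.
have := card_iso_deg (card_iso_compl fP) xv; rewrite dx cxv.
case: (boolP (compl e' (f x) v)) => [cfx|_]; last by have := k_min (f x); lia.
move=> /addIn <-; split=> //; apply: (card_iso_kdeg _ fP) => //.
by case/andP: cfx.
Qed.

(** With [predT] for [P] this compares all such non-neighbours, with [pred1 t] those of clique
    degree [t]. *)
Lemma nonneighbour_count_le (e e' : rel V) v f r (P : pred nat) :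
  (forall y, k <= deg (compl e') y) -> card_iso e e' v f ->
  #|[set x in codeg_set e | compl e x v && P (kdeg e r x)]| <=
  #|[set x in codeg_set e' | compl e' x v && P (kdeg e' r x)]|.
Proof.
move=> k_min fP; rewrite -(card_imset _ (@perm_inj _ f)); apply: subset_leq_card.
apply/subsetP => _ /imsetP[x + ->]; rewrite inE => /and3P[xS cxv Px].
have [fxS cfx ax] := nonneighbour_transfer r k_min fP xS cxv.
by rewrite inE fxS cfx -ax.
Qed.
End MaxDegree.

(** * Isomorphisms and twins *)

Lemma cliques_iso (V : finType) (e e' : rel V) (f : {perm V}) r :
  (forall x y, e' (f x) (f y) = e x y) -> kcount e r = kcount e' r.
Proof.
have le (g g' : rel V) (h : {perm V}) : (forall x y, g' (h x) (h y) = g x y) ->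
    kcount g r <= kcount g' r.
  move=> hE; have KE (d : rel V) : kcount d r = #|[set A in cliques d r | predT A]|.
    by apply: eq_card => A; rewrite [RHS]inE andbT.
  rewrite !KE; apply: (card_cliques_le (f := h)) => [|A _]; first exact: perm_inj.
  by split.
move=> fE; apply/eqP; rewrite eqn_leq (le _ _ f) //= (le _ _ f^-1%g) // => x y.
by rewrite -fE !permKV.
Qed.

Lemma kdeg_iso (V : finType) (e : rel V) (f : {perm V}) r x :
  (forall y z, e (f y) (f z) = e y z) -> kdeg e r x <= kdeg e r (f x).
Proof.
move=> fE; apply: (card_cliques_le (f := f)) => [|A xA]; first exact: perm_inj.
by split=> [y z _ _|]; rewrite ?fE // (mem_imset _ _ perm_inj).
Qed.

(** Distinct such [x] and [y] are adjacent and have the same other neighbours, so their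
    transposition is an automorphism. *)
Lemma kdeg_twins (V : finType) (e : rel V) r x y : symmetric e -> irreflexive e ->
  compl e x =1 compl e y -> kdeg e r x = kdeg e r y.
Proof.
move=> e_sym e_irr cxy; have exy z : z != x -> z != y -> e x z = e y z.
  move=> zx zy; have := cxy z; rewrite /compl ![_ == z]eq_sym zx zy /=.
  exact: negb_inj.
have tE u v : e (tperm x y u) (tperm x y v) = e u v.
  case: tpermP => [->|->|/eqP ux /eqP uy]; case: tpermP => [->|->|/eqP vx /eqP vy];
    rewrite ?e_irr //.
  - by rewrite exy.
  - by rewrite exy.
  - by rewrite ![e u _]e_sym exy.
  - by rewrite ![e u _]e_sym exy.
have := kdeg_iso r x tE; have := kdeg_iso r y tE; rewrite tpermL tpermR.
by move=> yx xy; apply: anti_leq; rewrite xy yx.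
Qed.

(** * From [r]-cliques to [r.+1]-cliques through the vertices of least co-degree *)

Section Step.
Variables (V : finType) (e e' : rel V) (v0 : V) (r k D : nat).
Hypotheses (e_sym : symmetric e) (e_irr : irreflexive e).
Hypotheses (e'_sym : symmetric e') (e'_irr : irreflexive e').
Hypothesis cards : same_cards e e' v0.
Hypothesis degE : forall x, deg (compl e) x = deg (compl e') x.
Hypothesis k_min : forall x, k <= deg (compl e) x.
Hypothesis (D_gt0 : 0 < D) (kcountD : kcount e r.+1 = kcount e' r.+1 + D).
Hypothesis r_lt : r.+2 < #|V|.

Local Notation c := (compl e).
Local Notation c' := (compl e').
Local Notation a := (kdeg e r.+1).
Local Notation b := (kdeg e' r.+1).
Local Notation S := (codeg_set k e).
Local Notation L := (#|V|.-1 - r.+1).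

Let codeg_setE : codeg_set k e' = S.
Proof. by apply/setP => x; rewrite !inE degE. Qed.

Let k_min' x : k <= deg c' x. Proof. by rewrite -degE. Qed.

Let c_sym := compl_sym e_sym.
Let c'_sym := compl_sym e'_sym.

Let kdegD x : x != v0 -> a x = b x + D.
Proof. exact: kdeg_same_cards cards kcountD _. Qed.

Let kdeg_v0 : b v0 = a v0 + L * D.
Proof. by apply: kdeg_special cards _ kcountD; lia. Qed.

Lemma transfer v x : v != v0 -> x \in S -> c x v ->
  exists z, [/\ z \in S, c' z v & b z = a x].
Proof.
move=> /cards[f fP] xS cxv; exists (f x).
by have [] := nonneighbour_transfer r.+1 k_min' fP xS cxv; rewrite codeg_setE.
Qed.

Lemma transfer' v x : v != v0 -> x \in S -> c' x v ->
  exists z, [/\ z \in S, c z v & a z = b x].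
Proof.
move=> /cards[f /card_iso_sym fP]; rewrite -{1}codeg_setE => xS cxv.
exists (f^-1%g x).
by have [] := nonneighbour_transfer r.+1 k_min fP xS cxv.
Qed.

(** Here [h] stands for the clique degree in [g]. The same [S] serves both graphs because their
    co-degrees agree. *)
Definition ncount (g : rel V) (h : V -> nat) (P : pred nat) (v : V) : nat :=
  #|[set x in S | compl g x v && P (h x)]|.

Lemma ncountE P v : v != v0 -> ncount e a P v = ncount e' b P v.
Proof.
move=> /cards[f fP]; apply/eqP; rewrite eqn_leq /ncount.
rewrite -{2}codeg_setE (nonneighbour_count_le _ _ k_min' fP) /=.
rewrite -{1}codeg_setE.
exact: (nonneighbour_count_le _ _ k_min (card_iso_sym fP)).
Qed.

Lemma sum_ncount (g : rel V) h P : symmetric (compl g) ->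
  (forall x, x \in S -> deg (compl g) x = k) ->
  \sum_v ncount g h P v = k * #|[set x in S | P (h x)]|.
Proof.
move=> g_sym gk.
transitivity (\sum_v \sum_(x in S | P (h x)) (compl g x v : nat)).
  apply: eq_bigr => v _; rewrite /ncount -sum1_card.
  rewrite (eq_bigl (fun x => (x \in S) && P (h x) && compl g x v)) => [|x].
    by rewrite big_mkcondr; apply: eq_bigr => x _; case: compl.
  by rewrite inE andbAC andbA.
rewrite exchange_big /= mulnC -sum_nat_const.
apply: eq_big => [x|x /andP[xS _]]; first by rewrite inE.
by rewrite -(gk x xS) /deg -sum1_card [RHS]big_mkcond; apply: eq_bigr => v _;
   rewrite inE; case: compl.
Qed.

Let degS x : x \in S -> deg c x = k. Proof. by rewrite inE => /eqP. Qed.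
Let degS' x : x \in S -> deg c' x = k. Proof. by rewrite -degE; apply: degS. Qed.

(** The cards give this off [v0]; both totals over [v] are [k * #|S|], so it extends to [v0]. *)
Lemma ncount_all v : ncount e a predT v = ncount e' b predT v.
Proof.
have [->|] := eqVneq v v0; last exact: ncountE.
have := sum_ncount a predT c_sym degS; have := sum_ncount b predT c'_sym degS'.
rewrite (bigD1 v0) //= [in X in _ -> X -> _](bigD1 v0) //=.
rewrite [in X in _ -> X -> _](eq_bigr (ncount e' b predT)); last exact: ncountE.
have -> : [set x in S | predT (a x)] = [set x in S | predT (b x)].
  by apply/setP => x; rewrite !inE.
by move=> <- /addIn.
Qed.

Lemma ncount_full (g : rel V) h v : symmetric (compl g) -> deg (compl g) v = k ->
  (ncount g h predT v = k) <-> (forall x, compl g v x -> x \in S).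
Proof.
move=> g_sym gk; have -> : ncount g h predT v = #|S :&: [set x | compl g v x]|.
  by apply: eq_card => x; rewrite !inE andbT g_sym.
split=> [cE x vx|sub]; last first.
  rewrite -[RHS]gk /deg (setIidPr _) //; apply/subsetP => x; rewrite [_ \in [set _ | _]]inE; apply: sub.
have /eqP/setIidPr/subsetP : S :&: [set x | compl g v x] == [set x | compl g v x].
  by rewrite eqEcard subsetIr /= cE -gk leqnn.
by apply; rewrite inE.
Qed.

(* On the card without v, the non-neighbours of v would be exactly the vertices
   of co-degree k - 1, so that the card would determine the whole graph. *)
Lemma nonneighbour_outside v : v != v0 -> v \in S -> exists2 x, c v x & x \notin S.
Proof.
move=> vv0 vS; apply/exists_inP; rewrite -negb_forall_in; apply/negP => /forall_inP sub.
have sub' x : c' v x -> x \in S.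
  apply: (ncount_full b c'_sym (degS' vS)).1; rewrite -ncount_all.
  exact: (ncount_full a c_sym (degS vS)).2.
have [f fP] := cards vv0; have [fv fE] := fP.
have cE x : c' (f x) v = c x v.
  apply/idP/idP => [cf|cx].
    have fxS : f x \in codeg_set k e' by rewrite codeg_setE sub' // c'_sym.
    have [] := nonneighbour_transfer 0 k_min (card_iso_sym fP) fxS cf.
    by rewrite permK.
  have xS : x \in S by rewrite sub // c_sym.
  by have [] := nonneighbour_transfer 0 k_min' fP xS cx.
have eE x : x != v -> e' (f x) v = e x v.
  by move=> xv; have := cE x; rewrite /compl xv (card_iso_neq _ fP) xv; apply: negb_inj.
suff : kcount e r.+1 = kcount e' r.+1 by move: kcountD D_gt0; lia.
apply: (cliques_iso (f := f)) => x y.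
have [->|xv] := eqVneq x v; have [->|yv] := eqVneq y v.
- by rewrite e_irr e'_irr.
- by rewrite fv e'_sym eE // e_sym.
- by rewrite fv eE.
- exact: fE.
Qed.

Lemma ncount_le (g : rel V) h P v : symmetric (compl g) -> deg (compl g) v = k ->
  ncount g h P v <= k.
Proof.
move=> g_sym gk; rewrite -[X in _ <= X]gk; apply: subset_leq_card.
by apply/subsetP => x; rewrite inE => /and3P[_ gxv _]; rewrite inE g_sym.
Qed.

Hypothesis kcount_r : kcount e r = kcount e' r.
Hypothesis kdeg_r : forall x, kdeg e r x = kdeg e' r x.

(** Sum [cliques_near_dominating] over [S]: the terms with [r]-cliques agree by induction, and the
    sum over non-neighbours, regrouped by non-neighbour, depends only on [ncount] with [predT]. *)
Lemma sum_kdeg_near_dominating : k <= 1 -> \sum_(x in S) a x = \sum_(x in S) b x.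
Proof.
move=> k1.
have swap (g : rel V) h : symmetric (compl g) ->
    \sum_(x in S) \sum_(v | compl g x v) kdeg e r v =
    \sum_v kdeg e r v * ncount g h predT v.
  move=> g_sym; under eq_bigr do rewrite big_mkcond.
  rewrite exchange_big; apply: eq_bigr => v _ /=; rewrite mulnC -sum_nat_const.
  rewrite [RHS](eq_bigl (fun x => (x \in S) && compl g x v)) ?big_mkcondr // => x.
  by rewrite [in LHS]inE andbT.
have eq_rest : \sum_(x in S) \sum_(v | c x v) kdeg e r v =
               \sum_(x in S) \sum_(v | c' x v) kdeg e r v.
  by rewrite (swap e a) // (swap e' b) //; apply: eq_bigr => v _; rewrite ncount_all.
apply: (@addIn (\sum_(x in S) kdeg e r x + \sum_(x in S) \sum_(v | c x v) kdeg e r v)).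
rewrite {2}eq_rest -!big_split /=; apply: eq_bigr => x xS; rewrite !addnA.
rewrite cliques_near_dominating ?degS // kcount_r.
rewrite -(cliques_near_dominating e'_sym r (u := x)) ?degS' //.
by rewrite kdeg_r; congr (_ + _); apply: eq_bigr => v _; rewrite kdeg_r.
Qed.

Let max_kdeg (A : {set V}) x1 : x1 \in A ->
  exists2 x, x \in A & forall y, y \in A -> a y <= a x.
Proof. by move=> x1A; case: (arg_maxnP a x1A) => x xA xmax; exists x. Qed.

(** Otherwise [a] exceeds [b] by [D] on all of [S]. For [k <= 1] this contradicts the equal sums.
    For larger [k], a vertex maximising [a] on [S] has a non-neighbour other than [v0], and transfer
    yields a still larger value of [a]. *)
Lemma special_codeg_min x1 : x1 \in S -> v0 \in S.
Proof.
move=> x1S; apply: contraT => v0S.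
have Sv0 x : x \in S -> x != v0 by apply: contraTneq => ->.
have [k1|k2] := leqP k 1.
  have := sum_kdeg_near_dominating k1.
  rewrite (eq_bigr (fun x => b x + D)) => [|x /Sv0 xv0]; last exact: kdegD.
  rewrite big_split sum_nat_const -[RHS]addn0 => /addnI /eqP.
  rewrite muln_eq0 => /orP[/eqP/card0_eq/(_ x1)|]; first by rewrite x1S.
  by rewrite eqn0Ngt D_gt0.
have [x xS xmax] := max_kdeg x1S.
have : 0 < #|[set v | c x v] :\ v0|.
  by have := degS xS; rewrite /deg (cardsD1 v0); case: (_ \in _); lia.
case/card_gt0P=> v /setD1P[vv0]; rewrite inE => cxv.
have [z [zS _ bz]] := transfer vv0 xS cxv.
by have := xmax z zS; rewrite kdegD ?Sv0 // bz; lia.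
Qed.

Hypothesis v0S : v0 \in S.

Let L_gt0 : 0 < L * D. Proof. by rewrite muln_gt0 D_gt0 subn_gt0; lia. Qed.

(** If [v0] dominated both graphs, its clique degree would be the number of [r]-cliques avoiding it,
    the same in both. *)
Lemma codeg_min_gt0 : 0 < k.
Proof.
rewrite lt0n; apply/eqP => k0.
have c0 : deg c v0 = 0 by rewrite degS.
have c'0 : deg c' v0 = 0 by rewrite degS'.
have sum0 (g : rel V) h : deg g v0 = 0 -> \sum_(v | g v0 v) h v = 0.
  by move/cards0_eq/setP=> g0; apply: big_pred0 => v; have := g0 v; rewrite !inE.
have := cliques_near_dominating e_sym r (u := v0).
have := cliques_near_dominating e'_sym r (u := v0).
rewrite c0 c'0 !sum0 // => /(_ isT) K' /(_ isT) K; move: L_gt0 kdeg_v0 K K'.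
by rewrite kdeg_r kcount_r; lia.
Qed.

(** Otherwise take [x] maximising [a] on [S] without [v0], and a non-neighbour [v] of [x] outside
    [S]. Transfer across the card of [v] cannot land on [v0], so it gives a larger value of [a]. *)
Lemma special_nonneighbour_outside : ncount e a predT v0 < k.
Proof.
rewrite ltn_neqAle ncount_le ?degS // andbT; apply/eqP => full.
have sub' x : c' v0 x -> x \in S.
  by apply: (ncount_full b c'_sym (degS' v0S)).1; rewrite -ncount_all.
have [x1 x1S] : exists x1, x1 \in S :\ v0.
  have : 0 < ncount e a predT v0 by rewrite full codeg_min_gt0.
  case/card_gt0P=> x; rewrite inE andbT => /andP[xS /andP[xv0 _]].
  by exists x; rewrite in_setD1 xv0.
have [x /setD1P[xv0 xS] xmax] := max_kdeg x1S.
have [v cxv vS] := nonneighbour_outside xv0 xS.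
have vv0 : v != v0 by apply: contraNneq vS => ->.
have [z [zS czv bz]] := transfer vv0 xS cxv.
have zv0 : z != v0 by apply: contraNneq vS => zv0; apply: sub'; rewrite -zv0.
have /xmax : z \in S :\ v0 by rewrite in_setD1 zv0.
by rewrite kdegD // bz; lia.
Qed.

(** Multiplied by [k], the two sides differ only by the contributions of [v0]. Both of these are
    below [k], so division by [k] removes them. *)
Lemma level_card t : #|[set x in S | a x == t]| = #|[set x in S | b x == t]|.
Proof.
have := sum_ncount a (pred1 t) c_sym degS; have := sum_ncount b (pred1 t) c'_sym degS'.
rewrite (bigD1 v0) //= [in X in _ -> X -> _](bigD1 v0) //=.
rewrite [in X in _ -> X -> _](eq_bigr (ncount e' b (pred1 t))); last exact: ncountE.
have lt (g : rel V) h : ncount g h predT v0 < k -> ncount g h (pred1 t) v0 < k.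
  apply: leq_ltn_trans; apply: subset_leq_card; apply/subsetP => x.
  by rewrite !inE => /and3P[-> ->].
have := lt e a special_nonneighbour_outside.
have := lt e' b; rewrite -ncount_all => /(_ special_nonneighbour_outside).
move: (ncount _ _ _ _) (ncount _ _ _ _) (\sum_(i | _) _) => p q s pk qk.
set m := #|_|; set n := #|_| => E1 E2.
have E : k * n + q = k * m + p by lia.
by have := congr1 (divn^~ k) E; rewrite ![k * _]mulnC !divnMDl ?divn_small ?addn0 //; lia.
Qed.

Local Notation level t := #|[set x in S :\ v0 | a x == t]|.

(** [level_card] with [v0] split off; for every other vertex, [b x = t] means [a x = t + D]. *)
Lemma level_rec t : level t + (t == a v0) = level (t + D) + (t == b v0).
Proof.
have := level_card t; rewrite (cardsD1 v0) [in RHS](cardsD1 v0) !inE.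
have -> : deg c v0 == k by rewrite degS.
rewrite /= addnC ![_ v0 == t]eq_sym [in RHS]addnC => E.
transitivity (#|[set x in S | a x == t] :\ v0| + (t == a v0)).
  by congr (_ + _); apply: eq_card => x; rewrite !inE; case: (x == v0).
rewrite E; congr (_ + _); apply: eq_card => x; rewrite !inE.
by case: eqP => //= /eqP xv0; rewrite kdegD // eqn_add2r.
Qed.

Lemma level_lt t : t < D -> level t = 0.
Proof.
move=> tD; apply: eq_card0 => x; rewrite !inE; apply/negP => /andP[/andP[xv0 _]].
by rewrite kdegD // => /eqP; lia.
Qed.

(** In steps of [D], the recursion starts from the empty levels below [D], gains one vertex just
    after [a v0] and loses it after [b v0]. *)
Lemma levelE t :
  level t = [&& a v0 < t, t <= b v0 & D %| t - a v0] :> nat.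
Proof.
have lD : 0 < L by move: L_gt0; rewrite muln_gt0 => /andP[].
elim/ltn_ind: t => t IH; have [tD|Dt] := ltnP t D.
  rewrite level_lt //; case: ltnP => //= at_; rewrite gtnNdvd ?andbF //; lia.
have := level_rec (t - D); rewrite subnK // IH; last by lia.
rewrite kdeg_v0; move: (L) lD (a v0) Dt => l lD al Dt.
have [s_lt|s_gt|s_eq] := ltngtP (t - D) al.
- rewrite /= (ltn_eqF (leq_trans s_lt (leq_addr _ _))) !addn0 => <-.
  case: ltnP => //= al_t; rewrite gtnNdvd ?andbF //; lia.
- have -> : t - al = (t - D - al) + D by lia.
  have alt : al < t by lia.
  rewrite alt dvdn_addl // addn0; have [/dvdnP[q Eq]|ndvd] := boolP (D %| _).
    have -> : t - D = al + q * D by lia.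
    have -> : t = al + q.+1 * D by rewrite mulSn; lia.
    rewrite !andbT eqn_add2l !leq_add2l !leq_pmul2r // eqn_pmul2r //=; lia.
  rewrite !andbF /=; case: eqP => [E|]; last by lia.
  by move: ndvd; rewrite E addKn dvdn_mull.
rewrite /= s_eq -{1}[al]addn0 eqn_add2l eq_sym muln_eq0 !gtn_eqF //= addn0 => <-.
have -> : t = al + D by lia.
by rewrite addKn dvdnn -[X in X < _]addn0 ltn_add2l D_gt0 leq_add2l leq_pmull.
Qed.

Lemma kdeg_inj : {in S &, injective a}.
Proof.
have nov0 x : x \in S -> x != v0 -> a x != a v0.
  move=> xS xv0; apply/eqP => E; have := levelE (a v0); rewrite ltnn /=.
  by move/card0_eq/(_ x); rewrite !inE xv0 E eqxx andbT => /negP; apply; rewrite inE in xS.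
move=> x y xS yS; have [->|xv0] := eqVneq x v0.
  by have [->//|yv0 E] := eqVneq y v0; have := nov0 _ yS yv0; rewrite E eqxx.
have [-> E|yv0 E] := eqVneq y v0; first by have := nov0 _ xS xv0; rewrite E eqxx.
have : level (a x) <= 1 by rewrite levelE; case: [&& _, _ & _].
by move/card_le1_eqP; apply; rewrite inE in_setD1 ?xv0 ?yv0 ?xS ?yS ?E eqxx.
Qed.

Lemma kdeg'_inj : {in S &, injective b}.
Proof.
move=> x y xS yS E; have : #|[set z in S | b z == b x]| <= 1.
  rewrite -level_card; apply/card_le1_eqP => u v; rewrite !in_set => /andP[uS /eqP au].
  by case/andP=> vS /eqP av; apply: kdeg_inj; rewrite ?inE // au av.
by move/card_le1_eqP; apply; rewrite inE ?xS ?yS ?E eqxx.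
Qed.

Lemma kdeg_progression x : x \in S -> exists2 j, j <= L & a x = a v0 + j * D.
Proof.
move=> xS; have [->|xv0] := eqVneq x v0; first by exists 0; rewrite ?addn0.
have : 0 < level (a x) by apply/card_gt0P; exists x; rewrite inE in_setD1 xv0 xS eqxx.
rewrite levelE; case: and3P => // -[ax xb /dvdnP[j Ej]] _.
exists j; last by rewrite -Ej; lia.
by rewrite -(leq_pmul2r D_gt0) -Ej leq_subLR -kdeg_v0.
Qed.

Lemma progression_kdeg j : j <= L -> exists2 x, x \in S & a x = a v0 + j * D.
Proof.
case: j => [|j] jL; first by exists v0; rewrite ?addn0.
have : 0 < level (a v0 + j.+1 * D).
  rewrite levelE kdeg_v0 addKn dvdn_mull // leq_add2l leq_pmul2r // jL.
  by rewrite -{1}[a v0]addn0 ltn_add2l muln_gt0 D_gt0.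
case/card_gt0P=> x; rewrite inE => /andP[/setD1P[_ xS] /eqP ax].
by exists x.
Qed.

(* Transferring a non-adjacency from e to e' and back moves the two endpoints one
   level towards each other. *)
Lemma codeg_min_adjacent_gap j x z : x \in S -> z \in S -> a z = a x + j * D -> ~~ c x z.
Proof.
elim/ltn_ind: j x z => -[|[|j]] IH x z xS zS E; apply/negP => cxz.
- have xz : x = z by apply: kdeg_inj => //; rewrite E addn0.
  by move: cxz; rewrite xz compl_irr.
(* In [e], [v0] has the least clique degree on [S]. *)
- have zv0 : z != v0.
    apply/eqP => zv0; have [i _ Ei] := kdeg_progression xS.
    by move: E D_gt0; rewrite zv0 Ei; lia.
  have [w [wS cwz bw]] := transfer zv0 xS cxz.
  have wz : w = z by apply: kdeg'_inj => //; move: E; rewrite bw kdegD // mul1n => /addIn.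
  by move: cwz; rewrite wz compl_irr.
have zv0 : z != v0.
  apply/eqP => zv0; have [i _ Ei] := kdeg_progression xS.
  by move: E D_gt0; rewrite zv0 Ei; lia.
have [w [wS cwz bw]] := transfer zv0 xS cxz.
(* If [w] were [v0], then [a x = b v0] would be the top value of [a] on [S], against [a x < a z]. *)
have wv0 : w != v0.
  apply/eqP => wv0; have [i iL Ei] := kdeg_progression zS.
  have iLD : i * D <= L * D by rewrite leq_mul2r iL orbT.
  by move: E kdeg_v0 iLD D_gt0; rewrite -wv0 bw wv0 Ei; lia.
have [y [yS cyw ay]] : exists y, [/\ y \in S, c y w & a y = b z].
  by apply: transfer' => //; rewrite c'_sym.
have gap : a y = a w + j * D.
  by move: E; rewrite ay kdegD // [a w]kdegD // bw !mulSn; lia.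
by have := IH j (ltnW (ltnSn _)) w y wS yS gap; rewrite c_sym cyw.
Qed.

Lemma codeg_min_adjacent x z : x \in S -> z \in S -> ~~ c x z.
Proof.
wlog xz : x z / a x <= a z => [W xS zS|xS zS].
  by have [xz|/ltnW zx] := leqP (a x) (a z); [|rewrite c_sym]; apply: W.
have [i _ Ei] := kdeg_progression xS; have [j _ Ej] := kdeg_progression zS.
apply: (codeg_min_adjacent_gap (j := j - i)) => //.
rewrite mulnBl; move: xz; rewrite Ei Ej; lia.
Qed.

Lemma card_codeg_min : #|V| - r.+1 <= #|S|.
Proof.
(* The default [v0] is never reached, since every level of the progression is inhabited. *)
pose g (j : 'I_L.+1) := odflt v0 [pick x in S | a x == a v0 + j * D].
have gP j : g j \in S /\ a (g j) = a v0 + j * D.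
  rewrite /g; case: pickP => [x /andP[xS /eqP]|no] //.
  have [x xS ax] := progression_kdeg (ltn_ord j).
  by have := no x; rewrite xS ax eqxx.
have g_inj : injective g.
  move=> i j E; apply/val_inj/eqP; rewrite -(eqn_pmul2r D_gt0) -(eqn_add2l (a v0)).
  by rewrite -(gP i).2 -(gP j).2 E.
have : #|[set g j | j : 'I_L.+1]| <= #|S|.
  by apply: subset_leq_card; apply/subsetP => _ /imsetP[j _ ->]; have [] := gP j.
by rewrite card_imset // card_ord; lia.
Qed.

Lemma codeg_min_bin : #|V| - r.+1 <= 'C(r.+1, k).
Proof.
have inj : {in S &, injective (fun x => [set y | c x y])}.
  move=> x y xS yS /setP E; apply: kdeg_inj => //.
  by apply: kdeg_twins => // z; have := E z; rewrite !inE.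
apply: leq_trans card_codeg_min _; rewrite -(card_in_imset inj).
have outS : #|~: S| <= r.+1.
  by have := card_codeg_min; have := cardsC S; move: r_lt; lia.
apply: leq_trans (leq_bin2l k outS); rewrite -cards_draws; apply: subset_leq_card.
apply/subsetP => _ /imsetP[x xS ->]; rewrite inE; apply/andP; split; last first.
  by apply/eqP; apply: degS.
apply/subsetP => y; rewrite inE => cxy; rewrite inE; apply: contraTN cxy => yS.
exact: codeg_min_adjacent.
Qed.
End Step.

(** Induction by Pascal's rule from [r = 3]; for [r = 2] and [k = 1] the bound fails, so edges need
    a separate argument. *)
Lemma bin_add_lt r k : 2 < r -> 'C(r, k) + r < 2 ^ r.
Proof.
elim: r k => // r IH k; rewrite ltnS leq_eqVlt => /orP[/eqP <-|r2].
  by case: k => [|[|[|[|k]]]].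
have r_lt : r < 2 ^ r by apply: ltn_expl.
case: k => [|k]; rewrite ?bin0 ?binS expnS; first by lia.
by have := IH k r2; have := IH k.+1 r2; lia.
Qed.

Lemma kcount_step (V : finType) (e e' : rel V) (v0 : V) r :
  symmetric e -> irreflexive e -> symmetric e' -> irreflexive e' ->
  same_cards e e' v0 -> (forall x, deg (compl e) x = deg (compl e') x) ->
  1 < r -> 2 ^ r.+1 <= #|V| ->
  kcount e r = kcount e' r -> (forall x, kdeg e r x = kdeg e' r x) ->
  kcount e r.+1 <= kcount e' r.+1.
Proof.
move=> e_sym e_irr e'_sym e'_irr cards degE r2 nV Kr dr.
rewrite leqNgt; apply/negP => lt.
pose D := kcount e r.+1 - kcount e' r.+1.
have D_gt0 : 0 < D by rewrite subn_gt0.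
have KD : kcount e r.+1 = kcount e' r.+1 + D by rewrite subnKC // ltnW.
case: (@arg_minnP V v0 xpredT (deg (compl e))) => // x1 _ x1_min.
pose k := deg (compl e) x1.
have x1S : x1 \in codeg_set k e by rewrite inE.
have k_min x : k <= deg (compl e) x by apply: x1_min.
have b3 := @bin_add_lt r.+1 k r2.
have nr : r.+2 < #|V| by have := @bin_add_lt r.+1 1 r2; rewrite bin1; lia.
have v0S := special_codeg_min e_sym e'_sym cards degE k_min D_gt0 KD nr Kr dr x1S.
have := codeg_min_bin e_sym e_irr e'_sym e'_irr cards degE k_min D_gt0 KD nr Kr dr v0S.
by lia.
Qed.

(** * The number of edges *)

Lemma leq_deg2 (V : finType) (g : rel V) x u w : u != w -> g x u + g x w <= deg g x.
Proof.
move=> uw; rewrite /deg (cardsD1 u) (cardsD1 w) !inE eq_sym uw /=.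
by rewrite addnA leq_addr.
Qed.

Lemma leq_deg1 (V : finType) (g : rel V) x u : g x u <= deg g x.
Proof. by rewrite /deg (cardsD1 u) inE leq_addr. Qed.

Lemma deg1_eq (V : finType) (g : rel V) x u w : deg g x <= 1 -> g x u -> g x w -> u = w.
Proof. by move/card_le1_eqP => H xu xw; apply: H; rewrite inE. Qed.

Lemma deg_gt0P (V : finType) (g : rel V) x : reflect (exists y, g x y) (0 < deg g x).
Proof. by apply: (iffP card_gt0P) => -[y gy]; exists y; rewrite inE in gy *. Qed.

(** A vertex of degree at most one serves at most one [v], so the choice of [x] is injective. *)
Lemma card_pendant_neighbours (V : finType) (g : rel V) (A Q : {set V}) :
  (forall v, v \in A -> exists x, [/\ x \in Q, deg g x <= 1 & g x v]) -> #|A| <= #|Q|.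
Proof.
move=> H; pose h v := odflt v [pick x in Q | (deg g x <= 1) && g x v].
have hP v : v \in A -> [/\ h v \in Q, deg g (h v) <= 1 & g (h v) v].
  move=> /H[x [xQ dx gx]]; rewrite /h.
  case: pickP => [y /and3P[] // |/(_ x)]; by rewrite xQ dx gx.
have inj : {in A &, injective h}.
  move=> u v /hP[_ du gu] /hP[_ _ gv] E; apply: deg1_eq du gu _; by rewrite E.
rewrite -(card_in_imset inj); apply: subset_leq_card.
by apply/subsetP => _ /imsetP[v /hP[hQ _ _] ->].
Qed.

(** * Isolated vertices on the cards *)

Section EdgeCount.
Variables (V : finType) (e e' : rel V) (v0 : V).
Hypothesis e_irr : irreflexive e.
Hypotheses (e'_sym : symmetric e') (e'_irr : irreflexive e').
Hypothesis cards : same_cards e e' v0.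
Hypothesis deg_shift : forall x, x != v0 -> deg e x = (deg e' x).+1.

(** Isolation on the card of [v]: in [g] itself, [x] may still be a pendant vertex attached to
    [v]. *)
Definition isolated (g : rel V) (v x : V) : Prop := x != v /\ deg g x = g x v.

Let isolated_card v f x : card_iso e e' v f -> isolated e v x -> isolated e' v (f x).
Proof.
move=> fP [xv dx]; split; first by rewrite (card_iso_neq _ fP).
by have := card_iso_deg fP xv; rewrite dx addnC => /addIn.
Qed.

Let isolated_card' v f x : card_iso e e' v f -> isolated e' v x ->
  isolated e v (f^-1%g x).
Proof.
move=> /card_iso_sym fP [xv dx]; split; first by rewrite (card_iso_neq _ fP).
by have := card_iso_deg fP xv; rewrite dx addnC => /addIn.
Qed.

Let isolated_nonneighbour v x : 1 < deg e' v0 -> v != v0 -> isolated e' v x ->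
  compl e' v0 x.
Proof.
move=> d1 vv0 [xv dx]; have xv0 : x != v0.
  by apply: contraTneq d1 => <-; rewrite dx; case: e'.
rewrite /compl eq_sym xv0 e'_sym; apply/negP => xv0'.
have := leq_deg2 e' x vv0; rewrite dx xv0'; lia.
Qed.

Lemma special_isolated : 5 < #|V| -> deg e v0 = 0 -> deg (compl e') v0 = 2 -> False.
Proof.
move=> nV d0 d2; pose Q := [set x | compl e' v0 x].
have cQ : #|Q| = 2 by [].
have big : 1 < deg e' v0 by have := deg_compl e'_irr v0; rewrite d2; lia.
have v0_isol v : v != v0 -> isolated e v v0.
  by move=> vv0; split; [rewrite eq_sym|have := leq_deg1 e v0 v; rewrite d0; lia].
(* Every card of [e'] other than that of [v0] has an isolated vertex, lying in [Q]. Were none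
   isolated in [e'], each [v] would have its own pendant in [Q]. *)
have [p pQ /eqP p0] : exists2 p, p \in Q & deg e' p == 0.
  apply/exists_inP; apply: contraT; rewrite negb_exists_in => /forall_inP no.
  have : #|[set: V] :\ v0| <= #|Q|.
    apply: (@card_pendant_neighbours _ e') => v /setD1P[vv0 _].
    have [f fP] := cards vv0; have := isolated_card fP (v0_isol v vv0).
    move=> zi; have zQ := isolated_nonneighbour big vv0 zi.
    have [zv dz] := zi; exists (f v0).
    have := no (f v0); rewrite inE zQ dz => /(_ isT).
    by case: (e' _ _).
  by have := cardsD1 v0 [set: V]; rewrite inE cardsT cQ; lia.
have pv0 : p != v0 by move: pQ; rewrite inE /compl eq_sym => /andP[].
(* The card of [p] has an isolated vertex too; it is not adjacent to [p], so it is isolated in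
   [e']. *)
have [q [qp qQ q0]] : exists q, [/\ q != p, q \in Q & deg e' q = 0].
  have [f fP] := cards pv0; have zi := isolated_card fP (v0_isol p pv0).
  exists (f v0); rewrite inE (isolated_nonneighbour big pv0 zi).
  have [-> ->] := zi; split=> //; apply/eqP; rewrite eqb0 e'_sym.
  by have := leq_deg1 e' p (f v0); rewrite p0; case: e'.
(* Each such card has two isolated vertices, hence one other than [v0] in [e]; by [deg_shift] it is
   pendant at [v] in [e] and isolated in [e']. *)
have : #|[set: V] :\ v0 :\ p :\ q| <= #|Q|.
  apply: (@card_pendant_neighbours _ e) => v /setD1P[vq /setD1P[vp /setD1P[vv0 _]]].
  have [f fP] := cards vv0.
  have isol' x : x != v -> deg e' x = 0 -> isolated e' v x.
    by move=> xv x0; split=> //; have := leq_deg1 e' x v; rewrite x0; lia.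
  have [x [xv0 xi]] : exists x, x != v0 /\ isolated e v x.
    have pi : isolated e v (f^-1%g p) by apply: (isolated_card' fP); apply: isol'; rewrite // eq_sym.
    have qi : isolated e v (f^-1%g q) by apply: (isolated_card' fP); apply: isol'; rewrite // eq_sym.
    have [E|] := eqVneq (f^-1%g p) v0; last by exists (f^-1%g p).
    by exists (f^-1%g q); rewrite -E (inj_eq perm_inj).
  have [xv dx] := xi; have := deg_shift xv0; rewrite dx; case exv: (e x v) => // -[x0].
  exists x; rewrite dx exv inE; split=> //.
  by apply: (isolated_nonneighbour big vv0); apply: isol'.
have := cardsD1 v0 [set: V]; have := cardsD1 p ([set: V] :\ v0).
have := cardsD1 q ([set: V] :\ v0 :\ p); rewrite !inE cardsT cQ; lia.
Qed.

Lemma special_pendant : 5 < #|V| -> deg e v0 = 1 -> deg (compl e') v0 = 1 ->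
  (forall x, 0 < deg e' x) /\
  (forall p, compl e' v0 p -> deg e' p = 1 /\ exists2 u, e v0 u & e' p u).
Proof.
move=> nV d1 d1'.
have big : 1 < deg e' v0 by have := deg_compl e'_irr v0; rewrite d1'; lia.
have [u eu] : exists u, e v0 u by apply/deg_gt0P; rewrite d1.
have [p cp] : exists p, compl e' v0 p by apply/deg_gt0P; rewrite d1'.
have p_uniq x : compl e' v0 x -> x = p.
  by move=> cx; apply: (deg1_eq _ cx cp); rewrite d1'.
have uv0 : u != v0 by apply: contraTneq eu => ->; rewrite e_irr.
have pv0 : p != v0 by case/andP: cp; rewrite eq_sym.
(* On the card of [u], [v0] is isolated in [e]; its image can only be [p]. *)
have [pu dp] : isolated e' u p.
  have [f fP] := cards uv0.
  have v0i : isolated e u v0 by rewrite /isolated d1 eu eq_sym.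
  have zi := isolated_card fP v0i.
  by rewrite -(p_uniq _ (isolated_nonneighbour big uv0 zi)).
have isol' x v : deg e' x = 0 -> v != v0 -> x != v -> isolated e' v x.
  by move=> x0 vv0 xv; split=> //; have := leq_deg1 e' x v; rewrite x0; lia.
have isol_p x : deg e' x = 0 -> x = p.
  move=> x0; have [v] : exists v, v \in [set: V] :\ v0 :\ x.
    apply/card_gt0P; have := cardsD1 v0 [set: V].
    by have := cardsD1 x ([set: V] :\ v0); rewrite !inE cardsT; lia.
  rewrite !inE => /and3P[vx vv0 _]; apply: p_uniq.
  by apply: (isolated_nonneighbour big vv0); apply: isol'; rewrite // eq_sym.
have epu : e' p u.
  apply/negPn/negP => /negbTE epu; have p0 : deg e' p = 0 by rewrite dp epu.
  (* If [p] were isolated in [e'], it would be so on every such card, and its counterpart in [e]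
     would be [v0] or [p], pendant at [v]. *)
  have : #|[set: V] :\ v0 :\ p| <= #|[set v0; p]|.
    apply: (@card_pendant_neighbours _ e) => v /setD1P[vp /setD1P[vv0 _]].
    have [f fP] := cards vv0.
    have pi : isolated e' v p by apply: isol'; rewrite // eq_sym.
    have [xv dx] := isolated_card' fP pi; set x := (f^-1%g p) in xv dx.
    have dx1 : deg e x <= 1 by rewrite dx; case: e.
    have [xv0|xv0] := eqVneq x v0.
      exists x; rewrite {1}xv0 !inE eqxx; split=> //.
      by move: dx; rewrite xv0 d1; case: e.
    have := deg_shift xv0; rewrite dx; case exv: (e x v) => // -[x0].
    by exists x; rewrite {1}(isol_p x (esym x0)) !inE eqxx orbT.
  rewrite cards2; have := cardsD1 v0 [set: V].
  by have := cardsD1 p ([set: V] :\ v0); rewrite !inE cardsT; lia.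
have dp1 : deg e' p = 1 by rewrite dp epu.
split=> [x|q /p_uniq ->]; last by split=> //; exists u.
by rewrite lt0n; apply/eqP => x0; move: dp1; rewrite -(isol_p x x0) x0.
Qed.
End EdgeCount.

Lemma sum_card_rel (V : finType) (P : pred V) (M : {set V}) (R : rel V) :
  \sum_(v | P v) #|[set x in M | R x v]| = \sum_(x in M) #|[set v | P v && R x v]|.
Proof.
rewrite (eq_bigr (fun v => \sum_(x in M) (R x v : nat))) => [|v _].
  rewrite exchange_big; apply: eq_bigr => x _ /=; rewrite -sum1_card.
  rewrite [RHS](eq_bigl (fun v => P v && R x v)) => [|v]; last by rewrite inE.
  by rewrite big_mkcondr; apply: eq_bigr => v _; case: (R x v).
rewrite -sum1_card (eq_bigl (fun x => (x \in M) && R x v)) => [|x]; last by rewrite inE.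
by rewrite big_mkcondr; apply: eq_bigr => x _; case: (R x v).
Qed.

(** The vertices of degree at most one on the card of [v]. *)
Definition low (V : finType) (g : rel V) (v : V) : {set V} :=
  [set x | (x != v) && (deg g x <= (g x v).+1)].

Lemma card_low_le (V : finType) (g g' : rel V) v f :
  card_iso g g' v f -> #|low g v| <= #|low g' v|.
Proof.
move=> fP; rewrite -(card_imset _ (@perm_inj _ f)); apply: subset_leq_card.
apply/subsetP => _ /imsetP[x + ->]; rewrite !inE => /andP[xv dx].
by rewrite (card_iso_neq _ fP) xv /=; have := card_iso_deg fP xv; lia.
Qed.

Section Pendant.
Variables (V : finType) (e e' : rel V) (v0 : V).
Hypothesis e_irr : irreflexive e.
Hypotheses (e'_sym : symmetric e') (e'_irr : irreflexive e').
Hypothesis cards : same_cards e e' v0.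
Hypothesis deg_shift : forall x, x != v0 -> deg e x = (deg e' x).+1.
Hypotheses (d1 : deg e v0 = 1) (d1' : deg (compl e') v0 = 1).

Lemma few_low_degrees : 6 < #|V| -> (forall u, e v0 u -> 4 < deg e u) ->
  #|V| = 7 /\ #|[set x | (x != v0) && (deg e x <= 3)]| <= 2.
Proof.
move=> nV high.
have big : 4 < deg e' v0 by have := deg_compl e'_irr v0; rewrite d1'; lia.
have [deg_gt0 pend] := special_pendant e_irr e'_sym e'_irr cards deg_shift
  (ltnW nV) d1 d1'.
have [p cp] : exists p, compl e' v0 p by apply/deg_gt0P; rewrite d1'.
have [dp [u eu epu]] := pend p cp.
have uv0 : u != v0 by apply: contraTneq eu => ->; rewrite e_irr.
have pv0 : p != v0 by case/andP: cp; rewrite eq_sym.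
pose M j := [set x | deg e' x == j].
have Mv0 j x : j <= 4 -> x \in M j -> x != v0.
  by move=> j4; rewrite inE => /eqP dx; apply: contraTneq big => <-; rewrite dx -leqNgt.
(* Besides [p], the image of [v0] on the card of [p] has degree one in [e']: otherwise it would be
   [u], with degree 3 in [e], against [high]. *)
have M1 : 1 < #|M 1|.
  have [f fP] := cards pv0; have v0p : v0 != p by rewrite eq_sym.
  have := card_iso_deg fP v0p; rewrite d1.
  have -> : e v0 p = false.
    by apply/negP => /high; rewrite deg_shift // dp.
  rewrite addn0; case ez: (e' (f v0) p) => /esym dz.
    have zu : f v0 = u by apply: (deg1_eq _ _ epu); rewrite ?dp // e'_sym.
    by have := high u eu; rewrite deg_shift // -zu dz.
  apply/card_gt1P; exists (f v0), p; rewrite !inE dz dp; split=> //.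
  by rewrite (card_iso_neq _ fP).
have low_e' v : v != v0 ->
    #|[set x in M 1 | x != v]| + #|[set x in M 2 | e' x v]| <= #|low e' v|.
  move=> vv0; rewrite -cardsUI.
  have -> : [set x in M 1 | x != v] :&: [set x in M 2 | e' x v] = set0.
    by apply/setP => x; rewrite !inE; case: (deg e' x =P 1) => //= ->; rewrite andbF.
  rewrite cards0 addn0; apply: subset_leq_card; apply/subsetP => x; rewrite !inE.
  case/orP=> /andP[/eqP-> H]; first by rewrite H.
  by rewrite H andbT; apply: contraTneq H => ->; rewrite e'_irr.
(* Off [v0] all degrees in [e] are at least 2, so a low vertex has degree 2 in [e] and loses an edge
   to [v]. *)
have low_e v : v != v0 -> #|low e v| <= 1 + #|[set x in M 1 | e x v]|.
  move=> vv0; apply: leq_trans (_ : #|v0 |: [set x in M 1 | e x v]| <= _); last first.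
    by rewrite cardsU1 leq_add2r leq_b1.
  apply: subset_leq_card; apply/subsetP => x; rewrite !inE => /andP[xv].
  have [//|xv0] := eqVneq x v0; rewrite deg_shift //=; have := deg_gt0 x.
  by case: (e x v); lia.
have low_le v : v != v0 -> #|low e' v| <= #|low e v|.
  by case/cards=> f /card_iso_sym fP; apply: card_low_le fP.
have nV1 : #|[set v | v != v0]| = #|V|.-1.
  by rewrite -(cardsC1 v0); apply: eq_card => v; rewrite !inE.
have sum_le : \sum_(v | v != v0) (#|[set x in M 1 | x != v]| + #|[set x in M 2 | e' x v]|)
    <= \sum_(v | v != v0) (1 + #|[set x in M 1 | e x v]|).
  apply: leq_sum => v vv0.
  exact: leq_trans (low_e' v vv0) (leq_trans (low_le v vv0) (low_e v vv0)).
have s1 : \sum_(v | v != v0) #|[set x in M 1 | x != v]| = #|M 1| * (#|V| - 2).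
  rewrite (sum_card_rel _ _ (fun x v => x != v)) -sum_nat_const.
  apply: eq_bigr => x xM; have xv0 := Mv0 1 x isT xM.
  have -> : [set v | v != v0 & x != v] = [set: V] :\ v0 :\ x.
    by apply/setP => v; rewrite !inE andbT andbC eq_sym.
  have := cardsD1 v0 [set: V]; have := cardsD1 x ([set: V] :\ v0).
  by rewrite !inE xv0 cardsT; lia.
have s2 : #|M 2| <= \sum_(v | v != v0) #|[set x in M 2 | e' x v]|.
  rewrite sum_card_rel -sum1_card; apply: leq_sum => x; rewrite inE => /eqP dx.
  have := cardsD1 v0 [set v | e' x v]; rewrite -[#|[set v | e' x v]|]/(deg e' x) dx.
  have -> : [set v | e' x v] :\ v0 = [set v | v != v0 & e' x v].
    by apply/setP => v; rewrite !inE.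
  by case: (v0 \in _); lia.
have s3 : \sum_(v | v != v0) #|[set x in M 1 | e x v]| <= #|M 1| * 2.
  rewrite sum_card_rel -sum_nat_const; apply: leq_sum => x xM.
  have xv0 := Mv0 1 x isT xM; move: xM; rewrite inE => /eqP dx.
  rewrite -dx -deg_shift //; apply: subset_leq_card; apply/subsetP => v.
  by rewrite !inE => /andP[].
have s4 : \sum_(v | v != v0) 1 = #|V|.-1.
  by rewrite sum1dep_card nV1.
move: sum_le; rewrite !big_split /= s1 s4 => sum_le.
have bound : #|M 1| * (#|V| - 2) + #|M 2| <= #|V|.-1 + #|M 1| * 2.
  apply: leq_trans (leq_trans sum_le _); by rewrite ?leq_add2l.
(* The bound reads [#|M 1| * (#|V| - 4) + #|M 2| <= #|V| - 1], where [#|M 1|] is at least 2 and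
   [#|V|] at least 7. *)
have [m1 m2 n7] : [/\ #|M 1| = 2, #|M 2| = 0 & #|V| = 7].
  move: bound M1 nV; move: #|M 1| #|M 2| #|V| => i j n; case: i => [|[|[|i]]] //.
    by move=> bound _ nV; split; lia.
  move=> bound _ nV; exfalso.
  have : i.+3 * 5 <= i.+3 * (n - 2) by rewrite leq_mul2l; lia.
  have : 3 * (n - 4) <= i.+3 * (n - 4) by rewrite leq_mul2r; lia.
  have -> : i.+3 * (n - 2) = i.+3 * (n - 4) + i.+3 * 2 by rewrite -mulnDr; congr (_ * _); lia.
  by move: bound; lia.
split=> //; rewrite -m1; apply: subset_leq_card; apply/subsetP => x.
rewrite !inE => /andP[xv0]; rewrite deg_shift // => dx.
move/card0_eq/(_ x): m2; rewrite !inE; move: (deg_gt0 x) dx; lia.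
Qed.
End Pendant.

Lemma no_excess_edge (V : finType) (e e' : rel V) (v0 : V) D :
  symmetric e -> irreflexive e -> symmetric e' -> irreflexive e' ->
  same_cards e e' v0 -> 6 < #|V| -> kcount e 2 = kcount e' 2 + D -> D = 0.
Proof.
move=> e_sym e_irr e'_sym e'_irr cards nV KD; apply/eqP; rewrite -leqn0 leqNgt.
apply/negP => D_gt0.
have shift x : x != v0 -> deg e x = deg e' x + D.
  by move=> xv0; have := kdeg_same_cards cards KD xv0; rewrite !kdeg2.
have special : deg e' v0 = deg e v0 + (#|V|.-1 - 2) * D.
  by rewrite -!kdeg2 //; apply: kdeg_special cards _ KD; lia.
have dcE x := deg_compl e_irr x; have dcE' x := deg_compl e'_irr x.
(* For [D >= 2] the degree of [v0] in [e'] would be at least [2 * (#|V| - 3)], which exceeds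
   [#|V| - 1]. *)
have D1 : D = 1.
  case: D D_gt0 special {KD shift} => [|[|D]] // _ special.
  have : (#|V|.-1 - 2) * 2 <= (#|V|.-1 - 2) * D.+2 by rewrite leq_mul2l orbT.
  by have := dcE' v0; rewrite special; lia.
rewrite {}D1 in KD shift special; rewrite muln1 in special.
(* Complementation exchanges the roles: off [v0], [compl e'] has the larger degrees. *)
have dc_shift x : x != v0 -> deg (compl e') x = (deg (compl e) x).+1.
  by move=> xv0; have := shift x xv0; have := dcE x; have := dcE' x; lia.
have e_shift x : x != v0 -> deg e x = (deg e' x).+1 by rewrite -addn1; apply: shift.
have c_sym := compl_sym e_sym; have c_irr := @compl_irr _ e.
have c'_sym := compl_sym e'_sym; have c'_irr := @compl_irr _ e'.
have c_cards : same_cards (compl e') (compl e) v0.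
  exact/same_cards_sym/same_cards_compl.
have ccE x := deg_compl c_irr x.
have nV5 : 5 < #|V| by lia.
have [d0|[d1|d2]] : deg e v0 = 0 \/ deg e v0 = 1 \/ deg e v0 = 2.
  by have := dcE' v0; lia.
- apply: (special_isolated e'_sym e'_irr cards) => //.
  by have := dcE' v0; lia.
- have dc' : deg (compl e') v0 = 1 by have := dcE' v0; lia.
  have dcc : deg (compl (compl e)) v0 = 1 by have := ccE v0; have := dcE v0; lia.
  have [_ pend] := special_pendant e_irr e'_sym e'_irr cards e_shift nV5 d1 dc'.
  have [_ c_pend] := special_pendant c'_irr c_sym c_irr c_cards dc_shift nV5 dc' dcc.
  have ccK x y : compl (compl e) x y = e x y by apply: complK.
  have high u : e v0 u -> 4 < deg e u.
    by rewrite -ccK => /c_pend[du _]; have := dcE u; lia.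
  have c_high u : compl e' v0 u -> 4 < deg (compl e') u.
    by move=> /pend[du _]; have := dcE' u; lia.
  have [n7 few] := few_low_degrees e_irr e'_sym e'_irr cards e_shift d1 dc' nV high.
  have [_ c_few] :=
    few_low_degrees c'_irr c_sym c_irr c_cards dc_shift dc' dcc nV c_high.
  (* As [#|V| = 7], the degrees of [x] in [e] and in [compl e'] add up to 7, so one of them is at
     most 3. *)
  have : #|[set: V] :\ v0| <= 4.
    apply: leq_trans (leq_add few c_few); rewrite -cardsUI -[X in X <= _]addn0.
    apply: leq_add => //; apply: subset_leq_card; apply/subsetP => x.
    rewrite !inE andbT => xv0; rewrite xv0 /=.
    by have := dcE' x; have := e_shift x xv0; lia.
  by have := cardsD1 v0 [set: V]; rewrite inE cardsT; lia.
- apply: (special_isolated c_sym c_irr c_cards) => //.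
    by have := dcE' v0; lia.
  by have := ccE v0; have := dcE v0; lia.
Qed.

(** * Induction on the clique size, with edges as the base *)

Lemma kcount_same_cards (V : finType) (e e' : rel V) (v0 : V) r :
  symmetric e -> irreflexive e -> symmetric e' -> irreflexive e' ->
  same_cards e e' v0 -> 6 < #|V| -> 0 < r -> 2 ^ r <= #|V| ->
  kcount e r = kcount e' r.
Proof.
move=> e_sym e_irr e'_sym e'_irr cards nV.
have cards' := same_cards_sym cards.
have K2 : kcount e 2 = kcount e' 2.
  have [le|/ltnW le] := leqP (kcount e' 2) (kcount e 2).
    have KD : kcount e 2 = kcount e' 2 + (kcount e 2 - kcount e' 2) by lia.
    by have := no_excess_edge e_sym e_irr e'_sym e'_irr cards nV KD; lia.
  have KD : kcount e' 2 = kcount e 2 + (kcount e' 2 - kcount e 2) by lia.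
  by have := no_excess_edge e'_sym e'_irr e_sym e_irr cards' nV KD; lia.
(* The case [D = 0] of the two clique degree lemmas. *)
have kdegE s : s < #|V| -> kcount e s = kcount e' s ->
    forall x, kdeg e s x = kdeg e' s x.
  move=> sV; rewrite -[RHS]addn0 => Ks x; have [->|xv0] := eqVneq x v0.
    by have := kdeg_special cards sV Ks; rewrite muln0 addn0.
  by rewrite (kdeg_same_cards cards Ks xv0) addn0.
have degE x : deg (compl e) x = deg (compl e') x.
  have := kdegE 2 (ltn_trans (isT : 2 < 6) nV) K2 x; rewrite !kdeg2 // => dE.
  by have := deg_compl e_irr x; have := deg_compl e'_irr x; lia.
elim: r => // -[|[|r]] IH _ rV; first 1 last.
- exact: K2.
- have rV' : 2 ^ r.+2 <= #|V| by apply: leq_trans rV; rewrite leq_exp2l.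
  have Kr := IH isT rV'.
  have r_lt : r.+2 < #|V| by apply: leq_trans (ltn_expl _ _) rV'.
  have dr := kdegE _ r_lt Kr.
  apply: anti_leq; apply/andP; split.
    exact: (kcount_step e_sym e_irr e'_sym e'_irr cards degE).
  apply: (kcount_step e'_sym e'_irr e_sym e_irr cards') => // x.
by apply: eq_card => A; apply/cliquesP/cliquesP => -[/eqP/cards1P[x ->] _];
   rewrite cards1; split=> // u v; rewrite !inE => /eqP -> /eqP ->; rewrite eqxx.
Qed.

(** * Matching the common cards of two decks *)

Lemma perm_map_lift (T K : eqType) (f : T -> K) (s : seq T) (t : seq K) :
  perm_eq t (map f s) -> exists2 u, perm_eq u s & map f u = t.
Proof.
elim: t s => [|a t IH] s.
  by rewrite perm_sym => /perm_nilP; case: s => // _; exists [::].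
move=> E; have : a \in map f s by rewrite -(perm_mem E) mem_head.
case/mapP=> x xs ax; have xsP := perm_to_rem xs.
move: E; rewrite (permPr (perm_map f xsP)) /= -ax perm_cons => /IH[u uP <-].
by exists (x :: u); rewrite ?ax // (permPr xsP) perm_cons.
Qed.

Lemma perm_mset_common (K : choiceType) (s t : seq K) :
  exists d, perm_eq (enum_mset (seq_mset s `&` seq_mset t)%mset ++ d) s.
Proof.
set c := (_ `&` _)%mset; exists (enum_mset (seq_mset s `\` c)%mset).
apply/eq_seq_msetP/msetP => a.
rewrite !mset_seqE count_cat !count_mem_mset !msetE2 !mset_seqE; lia.
Qed.

Lemma card_del_vertex (G : sgraph) (v : G) : #|del_vertex v| = #|G|.-1.
Proof. by rewrite card_sig -(cardsC1 v); apply: eq_card => x; rewrite !inE. Qed.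

(** Both vertex sets are listed with the common cards first and in the same order; vertices at equal
    positions are matched. *)
Lemma common_cards_matching (G H : sgraph) : 1 < #|G| ->
  #|G| - 1 <= common_cards G H ->
  exists v0 : G, exists2 p : G -> H, bijective p &
    forall v, v != v0 -> giso (del_vertex v) (del_vertex (p v)).
Proof.
move=> nG common.
pose fG (v : G) := isoclass (del_vertex v); pose fH (v : H) := isoclass (del_vertex v).
pose c := enum_mset (deck G `&` deck H)%mset.
have size_c : #|G| - 1 <= size c by [].
have [d] : exists d, perm_eq (c ++ d) (map fG (enum G)) by apply: perm_mset_common.
have [d'] : exists d, perm_eq (c ++ d) (map fH (enum H)).
  by rewrite /c msetIC; apply: perm_mset_common.
move=> /perm_map_lift[uH uHP EH] /perm_map_lift[uG uGP EG].
have uG_uniq : uniq uG by rewrite (perm_uniq uGP) enum_uniq.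
have uH_uniq : uniq uH by rewrite (perm_uniq uHP) enum_uniq.
have uG_mem x : x \in uG by rewrite (perm_mem uGP) mem_enum.
have size_uG : size uG = #|G| by rewrite (perm_size uGP) -cardE.
have size_uH : size uH = #|H| by rewrite (perm_size uHP) -cardE.
have [x0 _] : exists x0 : G, true by have /card_gt0P[x0] := ltnW nG; exists x0.
have [y0 _] : exists y0 : H, true.
  have : 0 < size uH by rewrite -(size_map fH) EH size_cat; lia.
  by case: uH {uHP EH uH_uniq size_uH} => // y0; exists y0.
have common_card i : i < size c -> fG (nth x0 uG i) = fH (nth y0 uH i).
  move=> ic; have iG : i < size uG by rewrite -(size_map fG) EG size_cat ltn_addr.
  have iH : i < size uH by rewrite -(size_map fH) EH size_cat ltn_addr.
  rewrite -(nth_map _ (fG x0)) // -(nth_map _ (fG x0)) //.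
  by rewrite EG EH !nth_cat ic.
(* A common card has one vertex fewer than either graph. *)
have cardGH : #|G| = #|H|.
  have c_gt0 : 0 < size c by lia.
  have /isoclassP[h hb _] := common_card 0 c_gt0.
  have := bij_eq_card hb; rewrite !card_del_vertex.
  have : 0 < #|H| by apply/card_gt0P; exists y0.
  by move: nG; lia.
(* The last position is the only one whose cards may differ. *)
exists (nth x0 uG #|G|.-1), (fun x => nth y0 uH (index x uG)).
  apply: inj_card_bij; last by rewrite cardGH.
  move=> x y /eqP; rewrite nth_uniq ?size_uH -?cardGH -?size_uG ?index_mem //.
  by move/eqP/(congr1 (nth x0 uG)); rewrite !nth_index.
move=> v vv0; apply/isoclassP; rewrite -[LHS]/(fG v) -{1}(nth_index x0 (uG_mem v)).
apply: common_card; apply: leq_trans size_c.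
have : index v uG < #|G| by rewrite -size_uG index_mem.
have : index v uG != #|G|.-1 by apply: contraNneq vv0 => <-; rewrite nth_index.
lia.
Qed.

Lemma giso_card_iso (G H : sgraph) (p : G -> H) (v : G) : bijective p ->
  giso (del_vertex v) (del_vertex (p v)) ->
  exists f, card_iso (@sedge G) (fun x y => sedge (p x) (p y)) v f.
Proof.
move=> [q pK qK] [h hb hE].
have in_del x : x != v -> x \in [set~ v] by rewrite !inE.
(* The default value [v] is attained exactly at [v], which extends the isomorphism of cards to a
   permutation fixing [v]. *)
pose g x := if @insub _ (fun x => x \in [set~ v]) (del_vertex v) x is Some x'
            then q (val (h x')) else v.
have gE x (xv : x \in [set~ v]) : g x = q (val (h (exist _ x xv))).
  by rewrite /g insubT.
have gv : g v = v by rewrite /g insubN // !inE eqxx.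
have g_neq x : x != v -> g x != v.
  move=> xv; rewrite (gE x (in_del x xv)); apply: contraTneq (valP (h (exist _ x (in_del x xv)))).
  by move/(congr1 p); rewrite qK => E; rewrite !inE E eqxx.
have g_inj : injective g.
  move=> x y; have [->|xv] := eqVneq x v.
    by have [->//|yv] := eqVneq y v; rewrite gv => E; have := g_neq y yv; rewrite -E eqxx.
  have [->|yv] := eqVneq y v.
    by rewrite gv => E; have := g_neq x xv; rewrite E eqxx.
  rewrite (gE x (in_del x xv)) (gE y (in_del y yv)).
  by move/(can_inj qK)/val_inj/(bij_inj hb)/(congr1 val).
exists (perm g_inj); split=> [|x y xv yv]; rewrite !permE // (gE x (in_del x xv)).
by rewrite (gE y (in_del y yv)) !qK; apply: hE.
Qed.

Lemma clique_count_pullback (G H : sgraph) (p : G -> H) r : bijective p ->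
  clique_count r H = kcount (fun x y => sedge (p x) (p y)) r.
Proof.
move=> [q pK qK].
have KE (T : finType) (g : rel T) : kcount g r = #|[set A in cliques g r | predT A]|.
  by apply: eq_card => A; rewrite [RHS]inE andbT.
rewrite -[LHS]/(kcount (@sedge H) r) !KE; apply: anti_leq; apply/andP; split.
  apply: (card_cliques_le (f := q)) => [|A _]; first exact: can_inj qK.
  by split=> // x y _ _; rewrite !qK.
by apply: (card_cliques_le (f := p)) => [|A _]; first exact: can_inj pK.
Qed.

Lemma expn2_le_log2 (R : realType) (n r : nat) : 0 < n ->
  (r%:R <= log2 (n%:R : R))%R -> 2 ^ r <= n.
Proof.
move=> n0; rewrite /log2 ler_pdivlMr ?ln_gt0 ?ltr1n // mulr_natl -lnXn ?ltr0n //.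
by rewrite -natrX ler_ln ?ler_nat // qualifE /= ltr0n ?expn_gt0.
Qed.

Theorem theorem1p5 (R : realType) (G : sgraph) (n r : nat) :
  #|G| = n -> 7 <= n -> 1 <= r -> (r%:R <= log2 (n%:R : R))%R ->
  reconstructible_from (clique_count r) G (n - 1).
Proof.
move=> cardG n7 r1 rn H; rewrite -cardG => common.
have nr : 2 ^ r <= #|G| by rewrite cardG; apply: expn2_le_log2 rn; lia.
have [v0 [p p_bij p_iso]] : exists v0 : G, exists2 p : G -> H, bijective p &
    forall v, v != v0 -> giso (del_vertex v) (del_vertex (p v)).
  by apply: common_cards_matching common; rewrite cardG; lia.
rewrite (clique_count_pullback r p_bij); symmetry.
apply: (@kcount_same_cards G (@sedge G) _ v0); rewrite ?cardG //.
- exact: sedge_sym.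
- exact: sedge_irrefl.
- by move=> x y; apply: sedge_sym.
- by move=> x; apply: sedge_irrefl.
- by move=> v /p_iso; apply: giso_card_iso.
by rewrite -cardG.
Qed.
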